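(* If $C\subset\mathbb{R}^n$ is a full-dimensional polytope whose slack matrix has psd rank $k$, then $C$ has at most $k^{O(k^2 n)}$ facets.
   Context: Polytopes are assumed to have the origin in their interior. $\mathcal{S}_+^k$ is the cone of $k\times k$ real symmetric positive semidefinite matrices, with inner product $\langle A,B\rangle=\mathrm{tr}(AB)$. If $P=\{x\in\mathbb{R}^n : h_1(x)\ge0,\dots,h_f(x)\ge0\}$ is the irredundant inequality representation of a full-dimensional polytope $P$ with one affine inequality per facet (each $h_j$ unique up to positive scaling) and $p_1,\dots,p_v$ are the vertices of $P$, a slack matrix of $P$ is the $v\times f$ matrix with entries $h_j(p_i)$; it is unique up to positive scaling of its columns. The psd rank of a nonnegative $p\times q$ matrix $M$ is the smallest $k$ for which there exist $A_1,\dots,A_p,B_1,\dots,B_q\in\mathcal{S}_+^k$ with $\langle A_i,B_j\rangle=M_{ij}$ for all $i,j$. The notation $k^{O(k^2n)}$ means a bound of the form $k^{c k^2 n}$ with $c$ an absolute constant. *)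

(* Defs.v *)
From HB Require Import structures.
From mathcomp Require Import all_boot all_order all_algebra.
From mathcomp Require Import all_classical all_reals all_analysis.
Set Implicit Arguments.
Unset Strict Implicit.
Unset Printing Implicit Defensive.
Import Order.TTheory GRing.Theory Num.Theory.
Import numFieldNormedType.Exports.
Local Open Scope classical_set_scope.
Local Open Scope ring_scope.

(* Points of R^n are row vectors. *)

Section Psd.
Variable R : realType.

Definition psdmx k (A : 'M[R]_k) : Prop :=
  A^T = A /\ forall x : 'cV[R]_k, 0 <= (x^T *m A *m x) 0 0.

Definition psd_factorization p q (M : 'M[R]_(p, q)) k
    (A : 'I_p -> 'M[R]_k) (B : 'I_q -> 'M[R]_k) : Prop :=
  [/\ forall i, psdmx (A i), forall j, psdmx (B j)
    & forall i j, \tr (A i *m B j) = M i j].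

Definition has_psd_factorization p q (M : 'M[R]_(p, q)) (k : nat) : Prop :=
  exists (A : 'I_p -> 'M[R]_k) (B : 'I_q -> 'M[R]_k), psd_factorization M A B.

(* A relation rather than a function, since a matrix with a negative entry
   has no psd rank. *)
Definition psd_rank p q (M : 'M[R]_(p, q)) (k : nat) : Prop :=
  has_psd_factorization M k /\
  forall k', has_psd_factorization M k' -> (k <= k')%N.

End Psd.

Section Polytopes.
Variables (R : realType) (n : nat).
Implicit Types (C F : set 'rV[R]_n).

Definition dot (a x : 'rV[R]_n) : R := \sum_(i < n) a 0 i * x 0 i.

Definition conv_hull m (v : 'I_m -> 'rV[R]_n) : set 'rV[R]_n :=
  [set x | exists w : 'I_m -> R,
     [/\ forall i, 0 <= w i, \sum_(i < m) w i = 1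
       & x = \sum_(i < m) w i *: v i]].

Definition polytope C : Prop :=
  exists (m : nat) (v : 'I_m -> 'rV[R]_n), C = conv_hull v.

Definition affinely_independent d (p : 'I_d.+1 -> 'rV[R]_n) : Prop :=
  row_free (\matrix_(i < d) (p (lift ord0 i) - p ord0)).

(* [aff_dim C d]: the affine hull of C has dimension d; in particular C is
   nonempty. *)
Definition aff_dim C (d : nat) : Prop :=
  (exists p : 'I_d.+1 -> 'rV[R]_n,
     (forall i, C (p i)) /\ affinely_independent p) /\
  (forall p : 'I_d.+2 -> 'rV[R]_n,
     (forall i, C (p i)) -> ~ affinely_independent p).

Definition full_dimensional C : Prop := aff_dim C n.

(* Taking a = 0 gives the improper faces C and set0. *)
Definition face C F : Prop :=
  exists (a : 'rV[R]_n) (b : R),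
    (forall x, C x -> dot a x <= b) /\ F = C `&` [set x | dot a x = b].

Definition vertices C : set 'rV[R]_n := [set p | face C [set p]].

(* The faces of dimension n - 1; there are none when n = 0. *)
Definition facets C : set (set 'rV[R]_n) :=
  [set F | face C F /\ exists2 d, d.+1 = n & aff_dim F d].

(* The pair (a, b) encodes the affine function x |-> <a, x> + b. *)
Definition affine_fun : Type := ('rV[R]_n * R)%type.
Definition affine_eval (h : affine_fun) (x : 'rV[R]_n) : R := dot h.1 x + h.2.

Definition irredundant_representation f (h : 'I_f -> affine_fun) C : Prop :=
  C = [set x | forall j, 0 <= affine_eval (h j) x] /\
  forall j, C <> [set x | forall i, i != j -> 0 <= affine_eval (h i) x].

Definition slack_matrix v f (S : 'M[R]_(v, f)) C : Prop :=
  exists (h : 'I_f -> affine_fun) (p : 'I_v -> 'rV[R]_n),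
    [/\ irredundant_representation h C,
        set_bij [set: 'I_f] (facets C)
          (fun j => C `&` [set x | affine_eval (h j) x = 0]),
        set_bij [set: 'I_v] (vertices C) p
      & forall i j, S i j = affine_eval (h j) (p i)].

End Polytopes.

(* Main.v *)
(* An elementary substitute for quantifier elimination.  A facet of [C] is a point
   [y] of the polar of [C] for which the face [<y, x> = 1] of [C] contains [n]
   linearly independent points.  By the psd factorization, membership in [C] and
   in its polar is expressed by Gram matrices [W W^T], so these data are the real
   zeros of a system of quadratic equations in O(n k^2) unknowns ([n < k^2] because
   [C] is bounded), and the zeros project onto a finite set with one point per
   facet.  The number of points in such a projection is bounded as follows: let [g]
   be the sum of the squares of the equations.  For small [eps > 0] the function
   [g + eps * \sum_i x_i ^ 6] has a local minimum in the cell of each point, and its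
   critical points satisfy [x_i ^ 5 = r_i(x)] with [deg r_i < 5]; any set of such
   points has at most [5 ^ m] elements, since the functions on it are spanned by
   the monomials with exponents at most 4. *)
Require Import Defs.
From mathcomp Require Import all_boot all_order all_algebra.
From mathcomp Require Import all_classical all_reals all_analysis.
From mathcomp Require Import ring lra zify.
Import Order.TTheory GRing.Theory Num.Theory.
Import numFieldNormedType.Exports.
Set Implicit Arguments.
Unset Strict Implicit.
Unset Printing Implicit Defensive.
Local Open Scope classical_set_scope.
Local Open Scope ring_scope.
Local Open Scope card_scope.

(** * Polynomial functions *)

Section PolynomialFunctions.
Variables (R : realType) (m : nat).
Implicit Types (w : seq 'I_m) (f g : 'rV[R]_m -> R) (x : 'rV[R]_m).

(** A monomial is a word in the variables: its length is the total degree, and the exponent of a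
    variable is its number of occurrences. *)
Definition monomial w x : R := \prod_(i <- w) x 0 i.

Inductive polyfun d : ('rV[R]_m -> R) -> Prop :=
| polyfun0 : polyfun d (fun=> 0)
| polyfunZmonomial c w f :
    (size w <= d)%N -> polyfun d f ->
    polyfun d (fun x => c * monomial w x + f x).

Lemma polyfun_ext d f g : polyfun d f -> f =1 g -> polyfun d g.
Proof. by move=> + /funext <-. Qed.

Lemma polyfun_monomial d w : (size w <= d)%N -> polyfun d (monomial w).
Proof.
move=> sw; apply: polyfun_ext (polyfunZmonomial 1 sw (polyfun0 d)) _ => x.
by rewrite mul1r addr0.
Qed.

Lemma polyfunW d e f : (d <= e)%N -> polyfun d f -> polyfun e f.
Proof.
move=> de; elim=> [|c w g sw _ IH]; first exact: polyfun0.
by apply: polyfunZmonomial => //; apply: leq_trans de.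
Qed.

Lemma polyfunD d f g :
  polyfun d f -> polyfun d g -> polyfun d (fun x => f x + g x).
Proof.
move=> pf pg; elim: pf => [|c w h sw _ IH].
  by apply: polyfun_ext pg _ => x; rewrite add0r.
by apply: polyfun_ext (polyfunZmonomial c sw IH) _ => x; rewrite addrA.
Qed.

Lemma polyfunZ d c f : polyfun d f -> polyfun d (fun x => c * f x).
Proof.
elim=> [|b w h sw _ IH].
  by apply: polyfun_ext (polyfun0 d) _ => x; rewrite mulr0.
apply: polyfun_ext (polyfunZmonomial (c * b) sw IH) _ => x.
by rewrite mulrDr mulrA.
Qed.

Lemma polyfunC d c : polyfun d (fun=> c).
Proof.
have := polyfunZ c (@polyfun_monomial d [::] isT).
by move/polyfun_ext; apply=> x; rewrite /monomial big_nil mulr1.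
Qed.

Lemma polyfunB d f g :
  polyfun d f -> polyfun d g -> polyfun d (fun x => f x - g x).
Proof.
move=> pf pg; apply: polyfun_ext (polyfunD pf (polyfunZ (-1) pg)) _ => x.
by rewrite mulN1r.
Qed.

Lemma polyfun_coord i : polyfun 1 (fun x => x 0 i).
Proof.
apply: polyfun_ext (@polyfun_monomial 1 [:: i] isT) _ => x.
by rewrite /monomial big_seq1.
Qed.

Lemma polyfunM d e f g :
  polyfun d f -> polyfun e g -> polyfun (d + e) (fun x => f x * g x).
Proof.
move=> pf pg; elim: pf => [|c w h sw _ IH].
  by apply: polyfun_ext (polyfun0 _) _ => x; rewrite mul0r.
suff pm : polyfun (d + e) (fun x => monomial w x * g x).
  apply: polyfun_ext (polyfunD (polyfunZ c pm) IH) _ => x.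
  by rewrite mulrDl mulrA.
elim: pg => [|b v k sv _ IHk].
  by apply: polyfun_ext (polyfun0 _) _ => x; rewrite mulr0.
have swv : (size (w ++ v) <= d + e)%N by rewrite size_cat leq_add.
apply: polyfun_ext (polyfunZmonomial b swv IHk) _ => x.
by rewrite /monomial big_cat /= mulrDr mulrCA.
Qed.

Lemma polyfun_sum (I : Type) (r : seq I) (P : pred I) d (F : I -> 'rV[R]_m -> R) :
  (forall i, P i -> polyfun d (F i)) ->
  polyfun d (fun x => \sum_(i <- r | P i) F i x).
Proof.
move=> pF; elim: r => [|i r IH].
  by apply: polyfun_ext (polyfun0 d) _ => x; rewrite big_nil.
case Pi: (P i).
  apply: polyfun_ext (polyfunD (pF _ Pi) IH) _ => x.
  by rewrite big_cons Pi.
by apply: polyfun_ext IH _ => x; rewrite big_cons Pi.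
Qed.

Lemma polyfun_prod1 (I : Type) (r : seq I) (F : I -> 'rV[R]_m -> R) :
  (forall i, polyfun 1 (F i)) ->
  polyfun (size r) (fun x => \prod_(i <- r) F i x).
Proof.
move=> pF; elim: r => [|i r IH].
  by apply: polyfun_ext (polyfunC 0 1) _ => x; rewrite big_nil.
apply: polyfun_ext (polyfunM (pF i) IH) _ => x.
by rewrite big_cons.
Qed.

Lemma polyfun_sqr d f : polyfun d f -> polyfun (d + d) (fun x => f x ^+ 2).
Proof. by move=> pf; apply: polyfun_ext (polyfunM pf pf) _ => x; rewrite expr2. Qed.

Lemma polyfun_continuous d f : polyfun d f -> continuous f.
Proof.
elim=> [|c w h _ _ IH]; first exact: cst_continuous.
move=> x; apply: cvgD (IH x); apply: cvgM; first exact: cvg_cst.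
rewrite /monomial; elim: w => [|i w IHw].
  by under eq_fun do rewrite big_nil; rewrite big_nil; exact: cvg_cst.
under eq_fun do rewrite big_cons; rewrite big_cons.
by apply: cvgM => //; apply: coord_continuous.
Qed.

(* The partial derivative is recorded algebraically, as the linear coefficient
   of the restriction to a line. *)
Definition partial (i : 'I_m) f g := forall x, exists2 p : {poly R},
  forall t, f (x + t *: delta_mx 0 i) = p.[t] & p`_1 = g x.

Lemma partial_ext i f1 f2 g1 g2 :
  partial i f1 g1 -> f1 =1 f2 -> g1 =1 g2 -> partial i f2 g2.
Proof. by move=> + /funext <- /funext <-. Qed.

Lemma partial_coord i j :
  partial i (fun x => x 0 j) (fun=> (i == j)%:R).
Proof.
move=> x; exists ((i == j)%:R *: 'X + (x 0 j)%:P) => [t|].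
  by rewrite !hornerE !mxE eqxx /= eq_sym addrC mulrC.
by rewrite coefD coefZ coefX coefC /= mulr1 addr0.
Qed.

Lemma partial_cst i c : partial i (fun=> c) (fun=> 0).
Proof.
by move=> x; exists c%:P => [t|]; rewrite ?hornerC ?coefC.
Qed.

Lemma partialM i f g f' g' : partial i f f' -> partial i g g' ->
  partial i (fun x => f x * g x) (fun x => f' x * g x + f x * g' x).
Proof.
move=> df dg x; have [p fp p1] := df x; have [q gq q1] := dg x.
exists (p * q) => [t|]; first by rewrite hornerM fp gq.
rewrite coefM !big_ord_recl big_ord0 /= addr0 -!horner_coef0.
by rewrite -fp -gq scale0r addr0 p1 q1 addrC.
Qed.

Lemma partialD i f g f' g' : partial i f f' -> partial i g g' ->
  partial i (fun x => f x + g x) (fun x => f' x + g' x).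
Proof.
move=> df dg x; have [p fp p1] := df x; have [q gq q1] := dg x.
exists (p + q) => [t|]; first by rewrite hornerD fp gq.
by rewrite coefD p1 q1.
Qed.

Lemma partialZ i c f f' : partial i f f' ->
  partial i (fun x => c * f x) (fun x => c * f' x).
Proof.
move=> df x; have [p fp p1] := df x.
exists (c *: p) => [t|]; first by rewrite hornerZ fp.
by rewrite coefZ p1.
Qed.

Lemma partial_sum (I : Type) (r : seq I) i (F G : I -> 'rV[R]_m -> R) :
  (forall j, partial i (F j) (G j)) ->
  partial i (fun x => \sum_(j <- r) F j x) (fun x => \sum_(j <- r) G j x).
Proof.
move=> FG; elim: r => [|j r IH].
  by apply: partial_ext (partial_cst i 0) _ _ => x; rewrite big_nil.
by apply: partial_ext (partialD (FG j) IH) _ _ => x; rewrite big_cons.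
Qed.

Lemma partial_coordX i j d :
  partial i (fun x => x 0 j ^+ d.+1)
    (fun x => (i == j)%:R * d.+1%:R * x 0 j ^+ d).
Proof.
elim: d => [|d IH].
  by apply: partial_ext (partial_coord i j) _ _ => x; rewrite ?expr1 ?expr0 ?mulr1.
apply: partial_ext (partialM (partial_coord i j) IH) _ _ => x.
  by rewrite -exprS.
by rewrite [d.+2%:R]mulrS exprS; ring.
Qed.

Lemma polyfun_partial d f i : polyfun d f ->
  exists2 g, polyfun d.-1 g & partial i f g.
Proof.
elim=> [|c w h sw _ [h' ph' dh]].
  by exists (fun=> 0); [exact: polyfun0|exact: partial_cst].
suff [g pg dg] : exists2 g, polyfun (size w).-1 g & partial i (monomial w) g.
  exists (fun x => c * g x + h' x); last exact: partialD (partialZ c dg) dh.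
  by apply: polyfunD ph'; apply: polyfunZ; apply: polyfunW pg; case: (size w) sw; case: d.
elim: w {sw} => [|j w [g pg dg]].
  exists (fun=> 0); first exact: polyfun0.
  by apply: partial_ext (partial_cst i 1) _ _ => // x; rewrite /monomial big_nil.
have dxw : partial i (monomial (j :: w))
    (fun x => (i == j)%:R * monomial w x + x 0 j * g x).
  apply: partial_ext (partialM (partial_coord i j) dg) _ _ => // x.
  by rewrite /monomial big_cons.
case: w pg dg dxw => [|k w] pg dg dxw.
  exists (fun=> (i == j)%:R); first exact: polyfunC.
  by apply: partial_ext (partial_coord i j) _ _ => // x; rewrite /monomial big_seq1.
exists (fun x => (i == j)%:R * monomial (k :: w) x + x 0 j * g x) => //.
apply: polyfunD; last exact: polyfunM (polyfun_coord j) pg.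
by apply: polyfunZ; exact: polyfun_monomial.
Qed.

(** On a coordinate line [f] is a univariate polynomial with a local minimum at 0, so its linear
    coefficient, the derivative there, vanishes. *)
Lemma partial_local_min i f g x : partial i f g ->
  (\forall y \near x, f x <= f y) -> g x = 0.
Proof.
move=> /(_ x)[p fp <-] xmin.
have xp : \forall t \near (0 : R), p.[0] <= p.[t].
  have cx : (fun t : R => x + t *: delta_mx 0 i : 'rV[R]_m) @ 0 --> x.
    suff : (fun t : R => x + t *: delta_mx 0 i : 'rV[R]_m) @ 0 -->
        x + 0 *: delta_mx 0 i by rewrite scale0r addr0.
    by apply: cvgD; [exact: cvg_cst|apply: cvgZr_tmp; exact: cvg_id].
  have /nbhs_ballP[e e0 pmin] := cx _ xmin.
  apply/nbhs_ballP; exists e => // t /pmin /=.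
  by rewrite -!fp scale0r addr0.
have [e /= e0 pmin] := xp.
have ee : - e < e by rewrite (lt_trans (y := 0)) ?oppr_lt0.
have p0 : is_derive (0 : R) (1 : R) (horner p) 0.
  apply: (@derive1_at_min R (horner p) (- e) e 0); first exact: ltW.
  - by move=> t _; exact: derivable_horner.
  - by rewrite in_itv /= oppr_lt0 e0.
  - move=> t; rewrite in_itv /= => te; apply: pmin.
    by rewrite /= sub0r normrN ltr_norml.
have := @derive_val _ _ _ _ _ _ _ p0.
rewrite (@derive_val _ _ _ _ _ _ _ (is_derive_poly p 0)).
by rewrite horner_coef0 coef_deriv.
Qed.

Lemma monomial_split i w :
  monomial w =1 fun x => x 0 i ^+ count_mem i w *
    monomial [seq j <- w | j != i] x.
Proof.
move=> x; rewrite /monomial (bigID (pred1 i)) /=; congr (_ * _).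
  rewrite -big_filter (eq_big_seq (fun=> x 0 i)); last first.
    by move=> j; rewrite mem_filter => /andP[/eqP -> _].
  by rewrite big_const_seq count_predT size_filter iter_mulr_1.
by rewrite big_filter.
Qed.

Lemma monomial_count w x :
  monomial w x = \prod_i x 0 i ^+ count_mem i w.
Proof.
rewrite /monomial; elim: w => [|j w IH].
  by rewrite big_nil big1 // => i _; rewrite expr0.
rewrite big_cons IH (bigD1 j) //= [RHS](bigD1 j) //= eqxx exprS mulrA.
congr (_ * _); apply: eq_bigr => i; rewrite eq_sym => /negbTE ->.
by rewrite add0n.
Qed.

(* An elementary Bezout bound: as [x_i ^ d.+1] has lower degree on the set, all
   functions on it are spanned by the monomials with exponents at most [d]. *)
Lemma finite_zeros_bound d N (q : 'I_N -> 'rV[R]_m) (r : 'I_m -> 'rV[R]_m -> R) :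
  injective q -> (forall i, polyfun d (r i)) ->
  (forall i j, q j 0 i ^+ d.+1 = r i (q j)) ->
  (N <= d.+1 ^ m)%N.
Proof.
move=> qinj pr qr.
pose M := \matrix_(e < #|{ffun 'I_m -> 'I_d.+1}|, j < N)
  \prod_i q j 0 i ^+ (enum_val e i : nat).
pose ev (f : 'rV[R]_m -> R) : 'rV_N := \row_j f (q j).
(* Strong induction on the degree: an exponent above [d] lets [x_i ^ d.+1] be replaced by [r i],
   which lowers the degree; otherwise the monomial gives a row of [M]. *)
have evM : forall e f, polyfun e f -> (ev f <= M)%MS.
  move=> e; have [s] := ubnP e; elim: s e => // s IHs e es f.
  elim=> [|c w g sw _ IHg].
    by rewrite (_ : ev _ = 0) ?sub0mx //; apply/rowP => j; rewrite !mxE.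
  rewrite (_ : ev _ = c *: ev (monomial w) + ev g); last first.
    by apply/rowP => j; rewrite !mxE.
  apply: addmx_sub IHg; apply: scalemx_sub.
  have [/existsP[i wi]|] := boolP [exists i, (d < count_mem i w)%N]; last first.
    rewrite negb_exists => /forallP wlt.
    pose a : {ffun 'I_m -> 'I_d.+1} := [ffun i => inord (count_mem i w)].
    apply: submx_trans (row_sub (enum_rank a) M).
    rewrite (_ : ev _ = row (enum_rank a) M) //; apply/rowP => j.
    rewrite !mxE monomial_count; apply: eq_bigr => i _.
    by rewrite enum_rankK ffunE inordK // ltnS leqNgt wlt.
  (* [v] is [w] with [d.+1] copies of [i] removed, so the rewritten function has degree at most
     [d + size v = size w - 1]. *)
  pose v := nseq (count_mem i w - d.+1) i ++ [seq j <- w | j != i].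
  have sv : (d + size v < e)%N.
    move: sw; rewrite -(count_predC (pred1 i)) size_cat size_nseq size_filter.
    move: (count _ w) (count _ w) wi => a b; lia.
  rewrite (_ : ev _ = ev (fun x => r i x * monomial v x)); last first.
    apply/rowP => j; rewrite !mxE (monomial_split i) -qr.
    rewrite /monomial big_cat /= big_nseq iter_mulr_1 mulrA -exprD.
    by rewrite subnKC.
  apply: (IHs (d + size v)%N); first exact: leq_trans sv _.
  exact: polyfunM (pr i) (polyfun_monomial (leqnn _)).
(* Interpolation: a product of functions of degree at most 1, one killing each [q l] with [l != j],
   evaluates to the [j]-th unit vector. Hence [M] has rank [N], at most its number of rows. *)
have full : (1%:M <= M)%MS.
  apply/row_subP => j; rewrite row1.
  have sep l : l != j -> exists i, q j 0 i != q l 0 i.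
    move=> lj; apply/existsP; rewrite -negb_forall; apply: contra lj.
    by move=> /forallP qjl; apply/eqP/qinj/rowP => i; apply/esym/eqP.
  have /choice [h hP] : forall l, exists f, polyfun 1 f /\
      (f (q j) = 1 /\ (l != j -> f (q l) = 0)).
    move=> l; have [->|lj] := eqVneq l j.
      by exists (fun=> 1); split => //; exact: polyfunC.
    have [i qi] := sep l lj.
    exists (fun x => (q j 0 i - q l 0 i)^-1 * (x 0 i - q l 0 i)); split.
      by apply/polyfunZ/polyfunB; [exact: polyfun_coord|exact: polyfunC].
    by rewrite mulVf ?subr_eq0 //; split => // _; rewrite subrr mulr0.
  have /evM := @polyfun_prod1 _ (index_enum 'I_N) h (fun l => (hP l).1).
  rewrite (_ : ev _ = delta_mx 0 j) //; apply/rowP => l; rewrite !mxE eqxx /=.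
  have [->|lj] := eqVneq l j; first by rewrite big1 // => l' _; case: (hP l') => _ [].
  by rewrite (bigD1 l) //= (hP l).2.2 // mul0r.
have := mxrankS full; rewrite mxrank1 => /leq_trans; apply.
by apply: leq_trans (rank_leq_row _) _; rewrite card_ffun !card_ord.
Qed.

End PolynomialFunctions.

(** * Counting separated real zeros *)

Section CountingZeros.
Variables (R : realType) (m : nat).
Implicit Types (g : 'rV[R]_m -> R) (x : 'rV[R]_m).

(** The even exponent makes sublevel sets compact; the derivative has degree [2d + 1], above that of
    any derivative of a polynomial of degree at most [2d]. *)
Definition power_sum d x : R := \sum_i x 0 i ^+ d.*2.+2.

Lemma power_sum_ge0 d x : 0 <= power_sum d x.
Proof. by apply: sumr_ge0 => i _; rewrite exprn_even_ge0 //= odd_double. Qed.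

Lemma power_sum_continuous d : continuous (@power_sum d).
Proof.
apply: (@polyfun_continuous R m d.*2.+2).
have si (i : 'I_m) : (size (nseq d.*2.+2 i) <= d.*2.+2)%N by rewrite size_nseq.
apply: polyfun_ext (polyfun_sum _ (fun i _ => polyfun_monomial R (si i))) _ => x.
by apply: eq_bigr => i _; rewrite /monomial big_nseq iter_mulr_1.
Qed.

(** Either [|x_i| <= 1], or [|x_i|] is at most its power and hence at most [c]; the bound [1 + c]
    covers both cases without roots. *)
Lemma power_sum_coord d c x i : power_sum d x <= c -> `|x 0 i| <= 1 + c.
Proof.
move=> sxc; have xc : `|x 0 i| ^+ d.*2.+2 <= c.
  apply: le_trans sxc; rewrite /power_sum (bigD1 i) //= -normrX.
  have x0 j : 0 <= x 0 j ^+ d.*2.+2 by rewrite exprn_even_ge0 //= odd_double.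
  by rewrite ger0_norm // lerDl sumr_ge0.
have [x1|/ltW x1] := leP `|x 0 i| 1.
  by rewrite (le_trans x1) // lerDl (le_trans (power_sum_ge0 d x)).
rewrite (le_trans (y := c)) ?lerDr //; apply: le_trans xc.
by rewrite exprS ler_peMr // exprn_ege1.
Qed.

Lemma compact_power_sum d c (A : set 'rV[R]_m) :
  closed A -> compact (A `&` [set x | power_sum d x <= c]).
Proof.
move=> Acl.
have boxC : compact
    [set v : 'rV[R]_m | forall i, v ord0 i \in `[(- (1 + c)), (1 + c)]].
  apply: (@rV_compact _ _ (fun=> `[(- (1 + c)), (1 + c)]%classic)).
  by move=> _; apply: segment_compact.
apply: subclosed_compact boxC _ => [|x /= [_ /power_sum_coord sx] i].
  apply: closedI => //.
  apply: (@closed_comp _ _ (@power_sum d) [set y | y <= c]).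
    by move=> x _; exact: power_sum_continuous.
  exact: closed_le.
by rewrite in_itv /= -ler_norml.
Qed.

(* The minimum of [g + eps * power_sum] over the cell of [z j] stays off the
   boundary of the cell for small [eps], because [g] does not vanish there. *)
Lemma cell_local_min d N g (q : 'I_N -> 'rV[R]_m -> R) z j :
  continuous g -> (forall x, 0 <= g x) ->
  (forall l, continuous (q l)) -> (forall l x, 0 <= q l x) ->
  g z = 0 -> q j z = 0 ->
  (forall x, g x = 0 -> exists l, q l x = 0) ->
  (forall l l' x, q l x = 0 -> q l' x = 0 -> l = l') ->
  \forall eps \near 0^'+, exists x,
    (forall l, l != j -> q j x < q l x) /\
    \forall y \near x, g x + eps * power_sum d x <= g y + eps * power_sum d y.
Proof.
move=> gc g0 qc q0 gz qz gq qq.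
(* [K] is the closed cell of [z], where [q j] is least among the [q l]; [U] is the open part where
   it is strictly least. *)
pose K := [set x | forall l, q j x <= q l x].
pose U := [set x | forall l, l != j -> q j x < q l x].
pose c := power_sum d z.
have Kcl : closed K.
  rewrite (_ : K = \bigcap_(l in setT) [set x | 0 <= q l x - q j x]); last first.
    apply/seteqP; split=> x h l; first by move=> _; rewrite /= subr_ge0.
    by have := h l I; rewrite /= subr_ge0.
  apply: closed_bigI => l _.
  apply: (@closed_comp _ _ (fun x => q l x - q j x) [set y | 0 <= y]).
    by move=> x _; exact: (cvgB (qc l x) (qc j x)).
  exact: closed_ge.
have Uop : open U.
  rewrite openE => x Ux.
  suff : forall l, nbhs x [set y | l != j -> q j y < q l y].
    by move=> /filter_forall.
  move=> l.
  have [lj|lj] := boolP (l != j); last by apply: filterE.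
  have : nbhs x [set y | 0 < q l y - q j y].
    apply: open_nbhs_nbhs; split; last by rewrite /= subr_gt0 Ux.
    apply: (@open_comp _ _ (fun x => q l x - q j x) [set y | 0 < y]).
      by move=> y _; exact: (cvgB (qc l y) (qc j y)).
    exact: open_gt.
  by apply: filterS => y /=; rewrite subr_gt0.
have UK : U `<=` K.
  by move=> x Ux l; have [->|lj] := eqVneq l j => //; exact/ltW/Ux.
pose B := (K `&` ~` U) `&` [set x | power_sum d x <= c].
have Bco : compact B by apply: compact_power_sum; apply: closedI => //; exact: open_closedC.
(* A zero of [g] in [K] is a zero of some [q l], hence of [q j]; no other [q l'] vanishes there, so
   the point lies in [U]. *)
have Bg x : B x -> 0 < g x.
  move=> [[Kx nUx] _]; rewrite lt_neqAle g0 andbT eq_sym; apply/eqP => gx0.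
  have [l ql] := gq _ gx0; apply: nUx => l' l'j.
  have qj : q j x = 0 by apply/eqP; rewrite eq_le q0 andbT -ql; exact: Kx.
  rewrite lt_neqAle qj q0 andbT; apply: contra l'j => /eqP/esym ql'.
  by apply/eqP; exact: qq ql' qj.
have [eta eta0 Beta] : exists2 eta, 0 < eta & forall x, B x -> eta <= g x.
  have [->|/set0P B0] := eqVneq B set0; first by exists 1.
  have [x Bx xmin] := EVT_min_rV B0 Bco (continuous_subspaceT gc).
  exists (g x) => [|y By]; first by apply: Bg; exact: set_mem.
  by apply: xmin; exact: mem_set.
(* [c] may be 0, so [eps] is compared with [eta / (c + 1)] rather than [eta / c]. *)
have c1 : 0 < c + 1 by rewrite ltr_wpDl // power_sum_ge0.
near=> eps.
have eps0 : 0 < eps by near: eps; exact: nbhs_right_gt.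
have epsc : eps * c < eta.
  have : eps < eta / (c + 1) by near: eps; apply: nbhs_right_lt; exact: divr_gt0.
  rewrite ltr_pdivlMr //; apply: le_lt_trans.
  by rewrite ler_pM2l // lerDl.
have phic : continuous (fun x => g x + eps * power_sum d x).
  move=> x; apply: cvgD (gc x) _.
  exact: (cvgM (cvg_cst eps) (@power_sum_continuous d x)).
have Kz : K z by move=> l; rewrite qz.
have A0 : (K `&` [set x | power_sum d x <= c]) !=set0 by exists z; split => //=.
have [x Ax xmin] := EVT_min_rV A0 (compact_power_sum (d := d) (c := c) Kcl) (continuous_subspaceT phic).
have [Kx sx] : (K `&` [set x | power_sum d x <= c]) x by exact: set_mem.
have phix : g x + eps * power_sum d x <= eps * c.
  by have := xmin z; rewrite gz add0r; apply; apply: mem_set; split => //=.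
(* Comparison with [z] gives [g x <= eps * c < eta], which rules out [B]. *)
have Ux : U x.
  apply: contrapT => nUx; have := Beta x (conj (conj Kx nUx) sx).
  apply/negP; rewrite -ltNge; apply: le_lt_trans epsc; apply: le_trans phix.
  by rewrite lerDl mulr_ge0 ?power_sum_ge0 // ltW.
exists x; split => //.
have : nbhs x U by exact: open_nbhs_nbhs.
apply: filterS => y /UK Ky.
have [sy|/ltW sy] := leP (power_sum d y) c.
  by apply: xmin; apply: mem_set.
(* Where the power sum exceeds [c], the penalty alone is at least [eps * c], so the minimum on the
   compact part is a minimum on the whole cell. *)
apply: le_trans phix _; rewrite ler_wpDl // ler_pM2l //.
Unshelve. all: by end_near. Qed.

(** One [eps] serves all the finitely many cells. The local minima are distinct because the open
    cells are disjoint, and the critical equations express [x_i ^ (2d + 1)] by a polynomial of lower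
    degree. *)
Lemma separated_zeros_bound d N g (q : 'I_N -> 'rV[R]_m -> R) (z : 'I_N -> 'rV[R]_m) :
  polyfun d.*2 g -> (forall x, 0 <= g x) ->
  (forall j, continuous (q j)) -> (forall j x, 0 <= q j x) ->
  (forall j, g (z j) = 0) -> (forall j, q j (z j) = 0) ->
  (forall x, g x = 0 -> exists j, q j x = 0) ->
  (forall j l x, q j x = 0 -> q l x = 0 -> j = l) ->
  (N <= d.*2.+1 ^ m)%N.
Proof.
move=> pg g0 qc q0 gz qz gq qq.
have gc := polyfun_continuous pg.
have [eps eps0 epsP] : exists2 eps : R, 0 < eps & forall j, exists x,
    (forall l, l != j -> q j x < q l x) /\
    \forall y \near x, g x + eps * power_sum d x <= g y + eps * power_sum d y.
  have h : \forall eps \near (0 : R)^'+, 0 < eps /\ forall j, exists x,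
      (forall l, l != j -> q j x < q l x) /\
      \forall y \near x, g x + eps * power_sum d x <= g y + eps * power_sum d y.
    near=> eps; split; first by near: eps; exact: nbhs_right_gt.
    near: eps; apply: filter_forall => j.
    exact: (cell_local_min d gc g0 qc q0 (gz j) (qz j)).
  by have [eps [? ?]] := filter_ex h; exists eps.
have [p pP] := choice epsP.
have /choice [g' g'P] : forall i, exists f, polyfun d.*2.-1 f /\ partial i g f.
  by move=> i; have [f ? ?] := polyfun_partial i pg; exists f.
pose e := eps * d.*2.+2%:R.
have e0 : e != 0 by rewrite mulf_neq0 ?gt_eqF ?ltr0n.
apply: (@finite_zeros_bound _ _ d.*2 N p (fun i x => - e^-1 * g' i x)).
- move=> j l pjl; apply/eqP; apply: contrapT => /negP jl.
  have := (pP j).1 l; rewrite eq_sym => /(_ jl); rewrite pjl.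
  by have := (pP l).1 j jl; move=> /lt_trans h /h; rewrite ltxx.
- move=> i; apply: polyfunZ; apply: polyfunW (g'P i).1; exact: leq_pred.
- move=> i j; have := partial_local_min _ (pP j).2.
  move=> /(_ i (fun x => g' i x + eps * (d.*2.+2%:R * x 0 i ^+ d.*2.+1))).
  move=> h; apply: (mulfI e0); rewrite mulrA mulrN mulfV // mulN1r /e.
  apply/eqP; rewrite -subr_eq0 opprK addrC -mulrA; apply/eqP/h.
  apply: partialD (g'P i).2 _; apply: partialZ.
  apply: partial_ext (partial_sum (index_enum _) (fun k => @partial_coordX R m i k d.*2.+1)) _ _ => // x.
  rewrite (bigD1 i) //= eqxx mul1r big1 ?addr0 // => k ki.
  by rewrite eq_sym (negbTE ki) !mul0r.
Unshelve. all: by end_near. Qed.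

End CountingZeros.

(** * Psd matrices and polyhedra *)

Section PsdMatrices.
Variable R : realType.
Implicit Types k : nat.

Lemma psdmxD k (A B : 'M[R]_k) : psdmx A -> psdmx B -> psdmx (A + B).
Proof.
move=> [At A0] [Bt B0]; split=> [|x]; first by rewrite linearD /= At Bt.
by rewrite mulmxDr mulmxDl mxE addr_ge0.
Qed.

Lemma psdmxZ k (A : 'M[R]_k) c : 0 <= c -> psdmx A -> psdmx (c *: A).
Proof.
move=> c0 [At A0]; split=> [|x]; first by rewrite linearZ /= At.
by rewrite -scalemxAr -scalemxAl mxE mulr_ge0.
Qed.

(** By cyclicity, the trace sums the quadratic form of [A] over the columns of [W]. *)
Lemma psdmx_gram_tr_ge0 k (A W : 'M[R]_k) : psdmx A -> 0 <= \tr (A *m (W *m W^T)).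
Proof.
move=> [_ A0]; rewrite mulmxA mxtrace_mulC; apply: sumr_ge0 => i _.
have := A0 (col i W); congr (_ <= _).
by rewrite tr_col -row_mul mulmxA !mxE; apply: eq_bigr => j _; rewrite ![_ 0 j]mxE [col _ _ _ _]mxE.
Qed.

Lemma psdmx_CauchySchwarz k (A : 'M[R]_k) (x y : 'cV[R]_k) : psdmx A ->
  (x^T *m A *m y) 0 0 ^+ 2 <= (x^T *m A *m x) 0 0 * (y^T *m A *m y) 0 0.
Proof.
move=> [At A0].
have yx : (y^T *m A *m x) 0 0 = (x^T *m A *m y) 0 0.
  transitivity ((y^T *m A *m x)^T 0 0); first by rewrite [RHS]mxE.
  by rewrite !trmx_mul trmxK At mulmxA.
have q t : 0 <= (x^T *m A *m x) 0 0 + t * (x^T *m A *m y) 0 0 *+ 2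
    + t ^+ 2 * (y^T *m A *m y) 0 0.
  have := A0 (x + t *: y); congr (_ <= _).
  rewrite [(_ + _)^T]linearD /= [(_ *: _)^T]linearZ /= !mulmxDl !mulmxDr -!scalemxAl -!scalemxAr.
  have addE (P Q : 'M[R]_1) : (P + Q) 0 0 = P 0 0 + Q 0 0 by rewrite mxE.
  have scaleE c (P : 'M[R]_1) : (c *: P) 0 0 = c * P 0 0 by rewrite mxE.
  by rewrite !(addE, scaleE) yx; ring.
move: q (A0 x) (A0 y); move: (_ 0 0) (_ 0 0) (_ 0 0) => c b a q a0 c0.
have [c_0|cn0] := eqVneq c 0.
  suff -> : b = 0 by rewrite expr0n mulr_ge0.
  apply/eqP; apply: contraT => bn0.
  (* For [c = 0] the form is affine in [t], and this [t] gives it the value [-1]. *)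
  have := q (- (a + 1) / (b *+ 2)); rewrite c_0 mulr0 addr0.
  rewrite (_ : a + _ = -1) ?oppr_ge0 ?ler10 //.
  by field.
(* The minimum of the parabola, attained at [t = - b / c]. *)
have := q (- b / c); have cp : 0 < c by rewrite lt_neqAle eq_sym cn0.
rewrite (_ : a + _ + _ = (a * c - b ^+ 2) / c); last by field.
by rewrite pmulr_lge0 ?invr_gt0 // subr_ge0.
Qed.

Lemma psdmx_entry k (A : 'M[R]_k) i j :
  A i j = ((delta_mx i 0 : 'cV_k)^T *m A *m (delta_mx j 0 : 'cV_k)) 0 0.
Proof. by rewrite trmx_delta -rowE -colE !mxE. Qed.

(* One step of the Cholesky algorithm (with [1 / sqrt 0 = 0]). *)
Lemma psdmx_pivot k (A : 'M[R]_k) i : psdmx A ->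
  exists u : 'cV[R]_k, [/\ psdmx (A - u *m u^T),
    row i (A - u *m u^T) = 0 &
    forall l, row l A = 0 -> row l (A - u *m u^T) = 0].
Proof.
move=> Apsd; have [At A0] := Apsd.
have Aii : 0 <= A i i by rewrite (psdmx_entry A i i); exact: A0.
pose s := Num.sqrt (A i i).
have s2 : s ^+ 2 = A i i by rewrite sqr_sqrtr.
pose u := s^-1 *: col i A.
have uE a : u a 0 = A a i / s by rewrite !mxE mulrC.
(* A zero pivot forces a zero column, by Cauchy-Schwarz; then [u = 0] and nothing has to be
   eliminated. *)
have AiiN0 a : A i i = 0 -> A a i = 0.
  move=> A_0; have := psdmx_CauchySchwarz (delta_mx a 0) (delta_mx i 0) Apsd.
  by rewrite -!psdmx_entry A_0 mulr0 real_exprn_even_le0 ?num_real //= => /eqP.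
exists u; split.
- split=> [|x]; first by rewrite linearB /= trmx_mul trmxK At.
  have -> : (x^T *m (A - u *m u^T) *m x) 0 0 =
      (x^T *m A *m x) 0 0 - (x^T *m u) 0 0 * (u^T *m x) 0 0.
    rewrite mulmxBr mulmxBl !mulmxA -(mulmxA (x^T *m u)).
    by rewrite [LHS]mxE [X in _ + X]mxE [X in _ - X]mxE big_ord1.
  have -> : (u^T *m x) 0 0 = (x^T *m u) 0 0.
    by transitivity ((u^T *m x)^T 0 0); [rewrite [RHS]mxE|rewrite trmx_mul trmxK].
  rewrite subr_ge0 -expr2 /u -scalemxAr [X in X ^+ 2]mxE colE mulmxA exprMn exprVn s2.
  have [A_0|An0] := eqVneq (A i i) 0.
    by rewrite A_0 invr0 mul0r; exact: A0.
  have Ap : 0 < A i i by rewrite lt_neqAle eq_sym An0.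
  by rewrite mulrC ler_pdivrMr // (psdmx_entry A i i); exact: psdmx_CauchySchwarz.
- apply/rowP => a; rewrite !mxE big_ord1 [u^T 0 _]mxE !uE.
  have Aai : A i a = A a i by rewrite -{1}At mxE.
  rewrite Aai; have [A_0|An0] := eqVneq (A i i) 0.
    by rewrite (AiiN0 a A_0) !mul0r mulr0 subrr.
  have sn0 : s != 0 by apply: contra An0 => /eqP s0; rewrite -s2 s0 expr0n.
  by rewrite -s2; field.
- move=> l /rowP Al; apply/rowP => a; have := Al a; rewrite !mxE => ->.
  by rewrite big_ord1 [u^T 0 _]mxE !uE; have := Al i; rewrite !mxE => ->; rewrite !mul0r subrr.
Qed.

(** Pivoting on every index in turn preserves the rows already cleared, so the final remainder is 0;
    the pivot vectors are the columns of [W]. *)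
Lemma psdmx_gram k (A : 'M[R]_k) : psdmx A -> exists W : 'M[R]_k, A = W *m W^T.
Proof.
move=> Apsd.
have [u [_ rows0]] : exists u : 'I_k -> 'cV[R]_k,
    let D := A - \sum_(i <- enum 'I_k) u i *m (u i)^T in
    psdmx D /\ forall i, i \in enum 'I_k -> row i D = 0.
  elim: (enum 'I_k) (enum_uniq 'I_k) => [_|i r IH /= /andP[ir /IH[u [Dpsd D0]]]].
    by exists (fun=> 0); split => //; rewrite big_nil subr0.
  have [v [vpsd vi vr]] := psdmx_pivot i Dpsd.
  exists (fun l => if l == i then v else u l).
  rewrite big_cons eqxx (eq_big_seq (fun l => u l *m (u l)^T)); last first.
    by move=> l lr; case: eqP => // li; rewrite li (negbTE ir) in lr.
  rewrite [v *m _ + _]addrC opprD addrA; split => // l.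
  by rewrite in_cons => /predU1P[->//|/D0/vr].
exists (\matrix_(a, b) u b a 0); apply/matrixP => a b.
have := rows0 a; rewrite mem_enum => /(_ isT)/rowP/(_ b).
rewrite !mxE big_enum summxE => /eqP; rewrite subr_eq0 => /eqP ->.
by apply: eq_bigr => i _; rewrite !mxE big_ord1 !mxE.
Qed.

End PsdMatrices.

(** * Bounded intersections of half-spaces and their vertices *)

Section Polyhedra.
Variables (R : realType) (n : nat).
Implicit Types (C F : set 'rV[R]_n) (a x y u : 'rV[R]_n) (h : affine_fun R n).

Lemma dotE a x : dot a x = (a *m x^T) 0 0.
Proof. by rewrite mxE; apply: eq_bigr => i _; rewrite !mxE. Qed.

Lemma dotDr a x y : dot a (x + y) = dot a x + dot a y.
Proof. by rewrite !dotE linearD mulmxDr mxE. Qed.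

Lemma dotZr a c x : dot a (c *: x) = c * dot a x.
Proof. by rewrite !dotE linearZ -scalemxAr mxE. Qed.

Lemma dotZl a c x : dot (c *: a) x = c * dot a x.
Proof. by rewrite !dotE -scalemxAl mxE. Qed.

Lemma dot_sumr a (I : finType) (X : I -> 'rV[R]_n) :
  dot a (\sum_i X i) = \sum_i dot a (X i).
Proof.
elim/big_rec2: _ => [|i b x _ <-]; last by rewrite dotDr.
by rewrite -(scale0r (0 : 'rV_n)) dotZr mul0r.
Qed.

Lemma dot_suml (I : finType) (P : pred I) (X : I -> 'rV[R]_n) x :
  dot (\sum_(i | P i) X i) x = \sum_(i | P i) dot (X i) x.
Proof.
elim/big_rec2: _ => [|i b a _ <-]; first by rewrite dotE mul0mx mxE.
by rewrite !dotE mulmxDl mxE.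
Qed.

Lemma affine_eval_line h x u t :
  affine_eval h (x + t *: u) = affine_eval h x + t * dot h.1 u.
Proof. by rewrite /affine_eval dotDr dotZr addrAC. Qed.

Lemma affine_eval0 h : affine_eval h 0 = h.2.
Proof. by rewrite /affine_eval -(scale0r (0 : 'rV_n)) dotZr mul0r add0r. Qed.

(** Boundedness in the form used with inequalities; the starting point need not lie in [C]. *)
Definition no_ray C := forall x u, u != 0 -> exists2 t, 0 < t & ~ C (x + t *: u).

Lemma polytope_no_ray C : polytope C -> no_ray C.
Proof.
move=> [r [v ->]] x u un0.
have [i ui] : exists i, u 0 i != 0.
  apply/existsP; rewrite -negb_forall; apply: contra un0 => /forallP u0.
  by apply/eqP/rowP => i; rewrite mxE; apply/eqP.
pose M := \sum_l `|v l 0 i|.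
have M0 : 0 <= M by apply: sumr_ge0.
have u0 : 0 < `|u 0 i| by rewrite normr_gt0.
(* [M] bounds the [i]-th coordinate on the hull, and this [t] pushes it to absolute value at least
   [M + 1]. *)
exists ((M + `|x 0 i| + 1) / `|u 0 i|) => [|[w [w0 w1 yE]]].
  by rewrite divr_gt0 // ltr_wpDl // addr_ge0.
set t := _ / _ in yE.
have t0 : 0 <= t by rewrite divr_ge0 // addr_ge0 ?addr_ge0.
have wle l : w l <= 1 by rewrite -w1 (bigD1 l) //= lerDl sumr_ge0.
have : `|(x + t *: u) 0 i| <= M.
  rewrite yE summxE; apply: le_trans (ler_norm_sum _ _ _) _.
  by apply: ler_sum => l _; rewrite mxE normrM ger0_norm // ler_piMl.
rewrite !mxE => yM; have := ler_normB (x 0 i + t * u 0 i) (x 0 i).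
rewrite addrAC subrr add0r normrM (ger0_norm t0) /t divfK ?gt_eqF // -/t.
by lra.
Qed.

Section HalfspaceRepresentation.
Variables (C : set 'rV[R]_n) (f : nat) (h : 'I_f -> affine_fun R n).
Hypothesis Ch : C = [set x | forall j, 0 <= affine_eval (h j) x].
Hypothesis Cbd : no_ray C.

(** Some inequality decreases along [u], since otherwise the ray would stay in [C]. The smallest
    ratio of slack to rate of decrease is the time at which the first one becomes tight. *)
Lemma slide x u : C x -> u != 0 ->
  (forall j, affine_eval (h j) x = 0 -> dot (h j).1 u = 0) ->
  exists t, [/\ 0 < t, C (x + t *: u) &
    exists2 j, affine_eval (h j) x != 0 & affine_eval (h j) (x + t *: u) = 0].
Proof.
move=> Cx un0 tight; have x0 j : 0 <= affine_eval (h j) x by move: Cx; rewrite Ch; apply.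
have [s s0 nC] := Cbd x un0.
have [j0 j0u] : exists j, dot (h j).1 u < 0.
  apply: contrapT => nex; apply: nC; rewrite Ch => j.
  rewrite affine_eval_line addr_ge0 // mulr_ge0 ?(ltW s0) // leNgt.
  by apply/negP => ju; apply: nex; exists j.
pose ratio j := affine_eval (h j) x / - dot (h j).1 u.
case: (@Order.TotalTheory.arg_minP _ _ _ j0 (fun j => dot (h j).1 u < 0) ratio j0u).
move=> j ju jmin; exists (ratio j).
have xj : affine_eval (h j) x != 0.
  by apply/eqP => /tight ju0; rewrite ju0 ltxx in ju.
split.
- by rewrite divr_gt0 ?oppr_gt0 // lt_neqAle eq_sym xj x0.
- rewrite Ch => l; rewrite affine_eval_line.
  have [lu|lu] := leP 0 (dot (h l).1 u).
    by rewrite addr_ge0 // mulr_ge0 // divr_ge0 // oppr_ge0 ltW.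
  have := jmin l lu; rewrite {2}/ratio ler_pdivlMr ?oppr_gt0 //; lra.
- by exists j => //; rewrite affine_eval_line /ratio; field; rewrite lt_eqF.
Qed.

(* A point that is not a vertex lies between two points of [C] at which more
   of the inequalities are tight. *)
Lemma vertices_convex_ind (P : set 'rV[R]_n) :
  vertices C `<=` P ->
  (forall x y t, 0 <= t <= 1 -> P x -> P y -> P (t *: x + (1 - t) *: y)) ->
  C `<=` P.
Proof.
move=> vP convP x.
(* Induction on the number of inequalities that are not tight at [x]. *)
have [s] := ubnP #|[pred j | affine_eval (h j) x != 0]|.
elim: s x => // s IH x; rewrite ltnS => xs Cx.
have x0 j : 0 <= affine_eval (h j) x by move: Cx; rewrite Ch; apply.
have [[y [Cy yx ytight]]|nex] := pselect (exists y, [/\ C y, y != x &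
    forall j, affine_eval (h j) x = 0 -> affine_eval (h j) y = 0]); last first.
  (* If [x] is the only point of [C] where all of its tight inequalities are tight, their sum is a
     linear functional exposing [x]. *)
  apply: vP; pose T j := affine_eval (h j) x == 0.
  exists (- \sum_(j | T j) (h j).1), (\sum_(j | T j) (h j).2).
  have sumE y : dot (- \sum_(j | T j) (h j).1) y =
      \sum_(j | T j) (h j).2 - \sum_(j | T j) affine_eval (h j) y.
    rewrite -scaleN1r dotZl dot_suml mulN1r -sumrB -sumrN.
    by apply: eq_bigr => j _; rewrite /affine_eval opprD addrCA subrr addr0.
  split=> [y Cy|].
    rewrite sumE lerBlDr lerDl; apply: sumr_ge0 => j _.
    by move: Cy; rewrite Ch; apply.
  apply/seteqP; split=> [y ->|y [Cy]].
    split => //=; rewrite sumE [X in _ - X]big1 ?subr0 // => j.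
    by rewrite /T => /eqP.
  rewrite /= sumE => yT; apply: contrapT => yx; apply: nex.
  exists y; split => //; first exact/eqP.
  have y0 j : 0 <= affine_eval (h j) y by move: Cy; rewrite Ch; apply.
  move=> j /eqP jx; apply/eqP; have : \sum_(j | T j) affine_eval (h j) y == 0.
    by apply/eqP; move: yT; lra.
  by rewrite psumr_eq0 // => /allP/(_ j); rewrite mem_index_enum /T jx; apply.
pose u := y - x.
have un0 : u != 0 by rewrite subr_eq0.
have tight j : affine_eval (h j) x = 0 -> dot (h j).1 u = 0.
  move=> jx; have := affine_eval_line (h j) x u 1.
  by rewrite scale1r addrC subrK ytight // jx add0r mul1r => <-.
have tightN j : affine_eval (h j) x = 0 -> dot (h j).1 (- u) = 0.
  by move=> /tight ju; rewrite -scaleN1r dotZr ju mulr0.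
clearbody u.
(* Sliding along [u] or [- u] keeps the tight inequalities tight and adds one, so the induction
   hypothesis applies at both ends. *)
have step v : (forall j, affine_eval (h j) x = 0 -> dot (h j).1 v = 0) ->
    v != 0 -> exists2 t, 0 < t & P (x + t *: v).
  move=> vt vn0; have [t [t0 Ct [j jx jt]]] := slide Cx vn0 vt.
  exists t => //; apply: IH => //; apply: leq_trans xs; apply: proper_card.
  apply/properP; split; last by exists j; rewrite !inE ?jt ?eqxx.
  apply/fintype.subsetP => l; rewrite !inE; apply: contra => /eqP lx.
  by rewrite affine_eval_line lx vt // mulr0 addr0.
have [t t0 Pt] := step u tight un0.
have [t' t'0 Pt'] : exists2 t, 0 < t & P (x + t *: - u) by apply: step; rewrite ?oppr_eq0.
have tt : 0 < t + t' by rewrite addr_gt0.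
have -> : x = (t' / (t + t')) *: (x + t *: u) + (1 - t' / (t + t')) *: (x + t' *: - u).
  rewrite !scalerDr addrACA -scalerDl addrC subrKC scale1r.
  rewrite [t' *: - u]scalerN -scaleNr !scalerA -scalerDl.
  have -> : t' / (t + t') * t + (1 - t' / (t + t')) * - t' = 0.
    by field; rewrite gt_eqF.
  by rewrite scale0r add0r.
apply: convP => //.
apply/andP; split; first by rewrite divr_ge0 // ltW.
by rewrite ler_pdivrMr // mul1r lerDr ltW.
Qed.

End HalfspaceRepresentation.

End Polyhedra.

(** * Facets and dimension when the origin is interior *)

Section Facets.
Variable R : realType.

Lemma dot_row n p (X : 'M[R]_(p, n)) (a : 'rV[R]_n) l :
  dot a (row l X) = (X *m a^T) l 0.
Proof.
rewrite /dot !mxE; apply: eq_bigr => i _; by rewrite !mxE mulrC.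
Qed.

Lemma row_free_inj0 p q (X : 'M[R]_(p, q)) :
  (forall w : 'rV_p, w *m X = 0 -> w = 0) -> row_free X.
Proof.
move=> X0; rewrite -kermx_eq0; apply/eqP/row_matrixP => i.
by rewrite row0; apply: X0; rewrite -row_mul mulmx_ker row0.
Qed.

(** The hyperplane of the facet misses the origin, so [n] affinely independent points on it are
    linearly independent: applying [h] to a linear relation shows that its coefficients sum to 0. *)
Lemma facet_unitmx n (C : set 'rV[R]_n) (h : affine_fun R n) :
  h.2 != 0 -> facets C (C `&` [set x | affine_eval h x = 0]) ->
  exists2 X : 'M[R]_n, X \in unitmx &
    forall l, C (row l X) /\ affine_eval h (row l X) = 0.
Proof.
move=> h2 [_ [d dn [[p [pF pfree]] _]]]; move: dn C h h2 p pF pfree.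
case: n / => C h h2 p pF pfree.
pose X := \matrix_l p l.
have rowX l : row l X = p l by apply/rowP => a; rewrite !mxE.
exists X => [|l]; last by rewrite rowX; have [] := pF l.
rewrite -row_free_unit; apply: row_free_inj0 => w wX.
have wp : \sum_l w 0 l *: p l = 0.
  rewrite -[RHS]wX; apply/rowP => a; rewrite summxE mxE.
  by apply: eq_bigr => l _; rewrite !mxE.
have sw : \sum_l w 0 l = 0.
  apply: (mulIf h2); rewrite mul0r mulr_suml.
  transitivity (- dot h.1 (\sum_l w 0 l *: p l)).
    rewrite dot_sumr -sumrN; apply: eq_bigr => l _; rewrite dotZr -mulrN.
    have [_ /= /eqP] := pF l; rewrite /affine_eval addr_eq0 => /eqP ->.
    by rewrite opprK.
  by rewrite wp dotE trmx0 mulmx0 mxE oppr0.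
have wl : \row_i w 0 (lift ord0 i) = 0.
  apply: (row_free_inj pfree); rewrite mul0mx -[RHS]wp big_ord_recl.
  move: sw; rewrite big_ord_recl => /eqP; rewrite addr_eq0 => /eqP ->.
  apply/rowP => a; rewrite !mxE summxE mulNr mulr_suml addrC -sumrB.
  by apply: eq_bigr => i _; rewrite !mxE mulrBr.
apply/rowP => l; rewrite mxE; case: (unliftP ord0 l) => [i ->|->].
  by have /rowP/(_ i) := wl; rewrite !mxE.
move: sw; rewrite big_ord_recl big1 ?addr0 // => i _.
by have /rowP/(_ i) := wl; rewrite !mxE.
Qed.

(** Linearly independent points are affinely independent, so the face has dimension at least
    [n - 1]. If it had dimension [n], then [y] would be orthogonal to a basis, hence 0, against
    [dot y x = 1]. *)
Lemma unitmx_facet n (C : set 'rV[R]_n) (y : 'rV[R]_n) (X : 'M[R]_n) :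
  (0 < n)%N -> X \in unitmx ->
  (forall x, C x -> dot y x <= 1) ->
  (forall l, C (row l X)) -> (forall l, dot y (row l X) = 1) ->
  facets C (C `&` [set x | dot y x = 1]).
Proof.
case: n C y X => // d C y X _ Xu Cy CX yX.
split; first by exists y, 1.
exists d => //; split.
  exists (fun l => row l X); split=> [l|]; first by split; [exact: CX|exact: yX].
  apply: row_free_inj0 => w wD.
  pose w' : 'rV_d.+1 := \row_l if unlift ord0 l is Some i then w 0 i else - \sum_i w 0 i.
  have w'X : w' *m X = 0.
    rewrite -[RHS]wD; apply/rowP => a; rewrite !mxE big_ord_recl.
    rewrite !mxE unlift_none mulNr mulr_suml addrC -sumrB.
    by apply: eq_bigr => i _; rewrite !mxE liftK mulrBr.
  have w'0 : w' = 0.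
    by apply: (row_free_inj (_ : row_free X)); rewrite ?row_free_unit // mul0mx.
  by apply/rowP => i; have /rowP/(_ (lift ord0 i)) := w'0; rewrite !mxE liftK.
move=> p pF; rewrite /affinely_independent row_free_unit => Du.
have y0 : y^T = 0.
  rewrite -[LHS](mulKmx Du) (_ : _ *m y^T = 0) ?mulmx0 //.
  apply/colP => l; rewrite -dot_row rowK -scaleN1r dotDr dotZr.
  by have [_ /= ->] := pF (lift ord0 l); have [_ /= ->] := pF ord0; rewrite mxE mulN1r subrr.
by have := yX ord0; rewrite dot_row y0 mulmx0 mxE => /esym/eqP; rewrite oner_eq0.
Qed.

Lemma interior_dilate n (C : set 'rV[R]_n) (u : 'rV[R]_n) :
  interior C 0 -> exists2 t, 0 < t & C (t *: u).
Proof.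
move=> C0.
have cu : (fun t : R => t *: u) @ 0 --> (0 : 'rV[R]_n).
  suff : (fun t : R => t *: u) @ 0 --> 0 *: u by rewrite scale0r.
  by apply: cvgZr_tmp; exact: cvg_id.
have /nbhs_ballP[e /= e0 eC] := cu _ C0.
exists (e / 2); first by rewrite divr_gt0.
apply: eC; rewrite /ball /= sub0r normrN gtr0_norm ?divr_gt0 //.
by rewrite ltr_pdivrMr // ltr_pMr // ltr1n.
Qed.

(** With offset 0 the linear part would be nonnegative in every direction and its opposite, hence 0,
    and the inequality would be redundant. *)
Lemma irredundant_offset_gt0 n (C : set 'rV[R]_n) f (h : 'I_f -> affine_fun R n) j :
  interior C 0 -> irredundant_representation h C -> 0 < (h j).2.
Proof.
move=> C0 [Ch irr].
have h0 x l : C x -> 0 <= affine_eval (h l) x by rewrite Ch; apply.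
have hj0 : 0 <= (h j).2 by rewrite -affine_eval0; apply: h0; exact: nbhs_singleton C0.
rewrite lt_neqAle hj0 andbT; apply/eqP => hj.
have dot0 u : dot (h j).1 u = 0.
  have [t t0 Ct] := interior_dilate u C0.
  have [s s0 Cs] := interior_dilate (- u) C0.
  have := h0 _ j Ct; have := h0 _ j Cs.
  rewrite /affine_eval -hj !addr0 !dotZr -scaleN1r dotZr mulN1r.
  rewrite !pmulr_rge0 // oppr_ge0 => ule uge.
  by apply/eqP; rewrite eq_le ule uge.
apply: (irr j); rewrite {1}Ch; apply/seteqP; split=> x /= xh l; first by move=> _; exact: xh.
have [->|lj] := eqVneq l j; last exact: xh.
by rewrite /affine_eval dot0 -hj addr0.
Qed.

(* More than [k ^ 2] matrices are linearly dependent, and a dependency between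
   those representing affinely independent points of [C] yields a ray. *)
Lemma dim_le_psd n (C : set 'rV[R]_n) f (h : 'I_f -> affine_fun R n) k
    (B : 'I_f -> 'M[R]_k) :
  interior C 0 -> irredundant_representation h C -> no_ray C -> (0 < f)%N ->
  (forall x, C x -> exists A, forall j, \tr (A *m B j) = affine_eval (h j) x) ->
  (n < k * k)%N.
Proof.
move=> C0 irr Cbd f0 rep; rewrite ltnNge; apply/negP => kn.
have hpos j := irredundant_offset_gt0 j C0 irr.
have /choice[e eP] : forall i : 'I_n, exists t, 0 < t /\ C (t *: delta_mx 0 i).
  by move=> i; have [t] := interior_dilate (delta_mx 0 i) C0; exists t.
(* The origin and a positive multiple of each basis vector: [n + 1] affinely independent points of
   [C]. *)
pose x (i : 'I_n.+1) : 'rV[R]_n :=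
  if unlift ord0 i is Some l then e l *: delta_mx 0 l else 0.
have Cx i : C (x i).
  rewrite /x; case: unlift => [l|]; first exact: (eP l).2.
  exact: nbhs_singleton C0.
have /choice[A AP] := fun i => rep (x i) (Cx i).
have nfree : ~~ row_free (\matrix_i mxvec (A i)).
  by rewrite /row_free neq_ltn (leq_ltn_trans (rank_leq_col _)).
have [c cn0 cA] : exists2 c : 'rV_n.+1, c != 0 & \sum_i c 0 i *: A i = 0.
  have [c cn0 cM] : exists2 c : 'rV_n.+1, c != 0 & c *m \matrix_i mxvec (A i) = 0.
    apply: contrapT => nex; move/negP: nfree; apply; apply: row_free_inj0 => w w0.
    by apply/eqP; apply: contrapT => /negP wn0; apply: nex; exists w.
  exists c => //; apply: (can_inj mxvecK); rewrite linear0 -[RHS]cM linear_sum /=.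
  apply/rowP => a; rewrite summxE mxE; apply: eq_bigr => i _.
  by rewrite linearZ !mxE.
pose s := \sum_i c 0 i; pose u := \sum_i c 0 i *: x i.
(* The dependency among the matrices [A i], traced against [B j], fixes the slope of every
   inequality along [u] as [- s] times its positive offset. *)
have su j : s * (h j).2 + dot (h j).1 u = 0.
  rewrite /s /u dot_sumr mulr_suml -big_split /=.
  transitivity (\tr ((\sum_i c 0 i *: A i) *m B j)); last by rewrite cA mul0mx linear0.
  rewrite mulmx_suml linear_sum /=; apply: eq_bigr => i _.
  by rewrite -scalemxAl linearZ /= AP /affine_eval dotZr; ring.
have un0 : u != 0.
  apply: contra cn0 => /eqP u0.
  have cl l : c 0 (lift ord0 l) = 0.
    have /rowP/(_ l) := u0; rewrite /u summxE mxE (bigD1 (lift ord0 l)) //= big1.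
      rewrite /x liftK !mxE !eqxx mulr1 addr0 => /eqP.
      by rewrite mulf_eq0 [e l == 0]gt_eqF ?(eP l).1 // orbF => /eqP.
    move=> i il; rewrite /x; case: unliftP il => [l' ->|->] il; last by rewrite !mxE mulr0.
    rewrite !mxE eqxx /= (_ : (l == l') = false) ?mulr0 //.
    by apply: contraNF il => /eqP ->.
  have s0 : s = 0.
    have := su (Ordinal f0); rewrite u0 dotE trmx0 mulmx0 mxE addr0 => /eqP.
    by rewrite mulf_eq0 [_.2 == 0]gt_eqF // orbF => /eqP.
  apply/eqP/rowP => i; rewrite mxE; case: (unliftP ord0 i) => [l ->//|->].
  by move: s0; rewrite /s big_ord_recl big1 ?addr0.
(* All slopes along [u] have the sign of [- s], so the ray from 0 along [u] or along [- u] never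
   leaves [C]. *)
have [s0|s0] := leP s 0.
  have [t t0] := Cbd 0 u un0; apply; rewrite irr.1 => j /=.
  rewrite affine_eval_line affine_eval0; have := su j; have := hpos j.
  move: (dot _ _) => b hj sb; have -> : b = - s * (h j).2 by lra.
  by rewrite addr_ge0 ?mulr_ge0 ?oppr_ge0 // ltW.
have [|t t0] := Cbd 0 (- u); first by rewrite oppr_eq0.
apply; rewrite irr.1 => j /=.
rewrite affine_eval_line affine_eval0 -scaleN1r dotZr; have := su j; have := hpos j.
move: (dot _ _) => b hj sb; have -> : b = - s * (h j).2 by lra.
by rewrite mulN1r mulNr opprK addr_ge0 ?mulr_ge0 // ltW.
Qed.

End Facets.

(** * The quadratic system of a psd factorization *)

Section Systems.
Variables (R : realType) (m : nat).

(** The system is replaced by the sum of the squares of its equations, of degree at most [2d]. *)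
Lemma common_zeros_bound d N (I : finType) (c : I -> 'rV[R]_m -> R)
    (q : 'I_N -> 'rV[R]_m -> R) (z : 'I_N -> 'rV[R]_m) :
  (forall e, polyfun d (c e)) ->
  (forall j, continuous (q j)) -> (forall j x, 0 <= q j x) ->
  (forall j e, c e (z j) = 0) -> (forall j, q j (z j) = 0) ->
  (forall x, (forall e, c e x = 0) -> exists j, q j x = 0) ->
  (forall j l x, q j x = 0 -> q l x = 0 -> j = l) ->
  (N <= d.*2.+1 ^ m)%N.
Proof.
move=> pc qc q0 cz qz cq qq.
apply: (@separated_zeros_bound _ _ d N (fun x => \sum_e c e x ^+ 2) q z) => //.
- by apply: polyfun_sum => e _; rewrite -addnn; exact: polyfun_sqr.
- by move=> x; apply: sumr_ge0 => e _; exact: sqr_ge0.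
- by move=> j; rewrite big1 // => e _; rewrite cz expr0n.
move=> x /eqP; rewrite psumr_eq0 => [/allP c0|e _]; last exact: sqr_ge0.
apply: cq => e; apply/eqP; rewrite -sqrf_eq0.
by have := c0 e; rewrite mem_index_enum; apply.
Qed.

Lemma polyfun_mulmx d e p r s (P : 'rV[R]_m -> 'M[R]_(p, r))
    (Q : 'rV[R]_m -> 'M[R]_(r, s)) :
  (forall a b, polyfun d (fun z => P z a b)) ->
  (forall a b, polyfun e (fun z => Q z a b)) ->
  forall a b, polyfun (d + e) (fun z => (P z *m Q z) a b).
Proof.
move=> pP pQ a b.
apply: polyfun_ext (polyfun_sum _ (fun i _ => polyfunM (pP a i) (pQ i b))) _ => z.
by rewrite mxE.
Qed.

Lemma polyfun_gram_tr r (A : 'M[R]_r) (W : 'rV[R]_m -> 'M[R]_r) :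
  (forall a b, polyfun 1 (fun z => W z a b)) ->
  polyfun 2 (fun z => \tr (A *m (W z *m (W z)^T))).
Proof.
move=> pW; apply: polyfun_sum => a _.
have pWt b b' : polyfun 1 (fun z => (W z)^T b b').
  by apply: polyfun_ext (pW b' b) _ => z; rewrite mxE.
have := polyfun_mulmx (fun b b' => polyfunC m 0 (A b b')) (polyfun_mulmx pW pWt).
exact.
Qed.

Lemma polyfun_dot d e r (x y : 'rV[R]_m -> 'rV[R]_r) :
  (forall a, polyfun d (fun z => x z 0 a)) ->
  (forall a, polyfun e (fun z => y z 0 a)) ->
  polyfun (d + e) (fun z => dot (x z) (y z)).
Proof. by move=> px py; apply: polyfun_sum => a _; exact: polyfunM. Qed.

End Systems.

Section SlackMatrix.
Variables (R : realType) (n : nat) (C : set 'rV[R]_n) (v f k : nat).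
Variables (S : 'M[R]_(v, f)) (h : 'I_f -> affine_fun R n) (p : 'I_v -> 'rV[R]_n).
Variables (A : 'I_v -> 'M[R]_k) (B : 'I_f -> 'M[R]_k).
Hypothesis C0 : interior C 0.
Hypothesis Cbd : no_ray C.
Hypothesis irr : irredundant_representation h C.
Hypothesis facetsC : set_bij [set: 'I_f] (facets C)
  (fun j => C `&` [set x | affine_eval (h j) x = 0]).
Hypothesis verticesC : set_bij [set: 'I_v] (vertices C) p.
Hypothesis slackS : forall i j, S i j = affine_eval (h j) (p i).
Hypothesis factorS : psd_factorization S A B.

Let CE x : C x = (forall j, 0 <= affine_eval (h j) x).
Proof. by rewrite irr.1. Qed.

Let h2_gt0 j : 0 < (h j).2.
Proof. exact: irredundant_offset_gt0 C0 irr. Qed.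

Let facet_hyperplane j : facets C (C `&` [set x | affine_eval (h j) x = 0]).
Proof. by have [sub _ _] := facetsC; apply: sub. Qed.

Let vertexE x : vertices C x -> exists i, x = p i.
Proof. by have [_ _ sur] := verticesC; move=> /sur [i _ <-]; exists i. Qed.

(** At the vertices the factors [A i] serve; elsewhere convex combinations of them do. *)
Lemma slack_psd_point x : C x ->
  exists2 D, psdmx D & forall j, \tr (D *m B j) = affine_eval (h j) x.
Proof.
have [Apsd _ AB] := factorS.
pose P := [set x | exists2 D : 'M[R]_k, psdmx D &
  forall j, \tr (D *m B j) = affine_eval (h j) x].
suff CP : C `<=` P by move=> /CP.
apply: (vertices_convex_ind irr.1 Cbd) => [y /vertexE[i ->]|y z t /andP[t0 t1]].
  by exists (A i) => // j; rewrite AB slackS.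
move=> [D Dpsd DB] [D' D'psd D'B]; exists (t *: D + (1 - t) *: D').
  by apply: psdmxD; apply: psdmxZ => //; rewrite subr_ge0.
move=> j; rewrite mulmxDl -!scalemxAl linearD !linearZ /= DB D'B.
by rewrite /affine_eval dotDr !dotZr; ring.
Qed.

(** The vertex of the polar of [C] dual to facet [j]; it does not change when [h j] is scaled by a
    positive factor. *)
Definition polar_point j : 'rV[R]_n := - (h j).2^-1 *: (h j).1.

Lemma polar_pointE j x :
  affine_eval (h j) x = (h j).2 * (1 - dot (polar_point j) x).
Proof. by rewrite /affine_eval /polar_point dotZl; field; rewrite gt_eqF ?h2_gt0. Qed.

Lemma polar_point_inj : injective polar_point.
Proof.
have tight j x : affine_eval (h j) x = 0 <-> dot (polar_point j) x = 1.
  rewrite polar_pointE; split=> [/eqP|->]; last by rewrite subrr mulr0.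
  by rewrite mulf_eq0 gt_eqF ?h2_gt0 //= subr_eq0 => /eqP.
move=> j l jl; have [_ inj _] := facetsC; apply: inj; rewrite ?in_setT //.
by apply/seteqP; split=> x [Cx] /= /tight xj; split=> //=; apply/tight; rewrite -xj jl.
Qed.

(* The unknowns are [W] and [V l] with Gram matrices [W W^T] and [V l (V l)^T]
   representing a point [y] of the polar of [C] and the points of [C] that are
   the rows of [X], together with the inverse [T] of [X]. *)
Definition unknown : finType :=
  (('I_k * 'I_k) + ('I_n * ('I_k * 'I_k)) + 'I_n + ('I_n * 'I_n) + ('I_n * 'I_n))%type.

Let m := #|unknown|.
Definition unknown_val (z : 'rV[R]_m) (i : unknown) := z 0 (enum_rank i).
Definition matW z : 'M[R]_k := \matrix_(a, b) unknown_val z (inl (inl (inl (inl (a, b))))).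
Definition matV l z : 'M[R]_k := \matrix_(a, b) unknown_val z (inl (inl (inl (inr (l, (a, b)))))).
Definition vecY z : 'rV[R]_n := \row_a unknown_val z (inl (inl (inr a))).
Definition matX z : 'M[R]_n := \matrix_(a, b) unknown_val z (inl (inr (a, b))).
Definition matT z : 'M[R]_n := \matrix_(a, b) unknown_val z (inr (a, b)).

(** The four families say that [y] lies in the polar of [C], that the rows of [X] lie in [C], that
    these rows lie on the face exposed by [y], and that [X] is invertible. *)
Definition equation (e : 'I_v + 'I_n * 'I_f + 'I_n + 'I_n * 'I_n) (z : 'rV[R]_m) : R :=
  match e with
  | inl (inl (inl i)) =>
      \tr (A i *m (matW z *m (matW z)^T)) - (1 - dot (vecY z) (p i))
  | inl (inl (inr (l, j))) =>
      \tr (B j *m (matV l z *m (matV l z)^T)) - affine_eval (h j) (row l (matX z))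
  | inl (inr l) => dot (vecY z) (row l (matX z)) - 1
  | inr (a, b) => (matX z *m matT z) a b - (a == b)%:R
  end.

Lemma equation_polyfun e : polyfun 2 (equation e).
Proof.
have pv i : polyfun 1 (fun z => unknown_val z i) by exact: polyfun_coord.
have pW a b : polyfun 1 (fun z => matW z a b).
  by apply: polyfun_ext (pv _) _ => z; rewrite mxE.
have pV l a b : polyfun 1 (fun z => matV l z a b).
  by apply: polyfun_ext (pv _) _ => z; rewrite mxE.
have pY a : polyfun 1 (fun z => vecY z 0 a).
  by apply: polyfun_ext (pv _) _ => z; rewrite mxE.
have pX a b : polyfun 1 (fun z => matX z a b).
  by apply: polyfun_ext (pv _) _ => z; rewrite mxE.
have pXr l b : polyfun 1 (fun z => row l (matX z) 0 b).
  by apply: polyfun_ext (pX l b) _ => z; rewrite [RHS]mxE.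
have pT a b : polyfun 1 (fun z => matT z a b).
  by apply: polyfun_ext (pv _) _ => z; rewrite mxE.
have pdot (x y : 'rV[R]_m -> 'rV[R]_n) d d' : (d + d' <= 2)%N ->
    (forall a, polyfun d (fun z => x z 0 a)) ->
    (forall a, polyfun d' (fun z => y z 0 a)) ->
    polyfun 2 (fun z => dot (x z) (y z)).
  by move=> de px py; apply: polyfunW de (polyfun_dot px py).
have pc (a : 'rV[R]_n) b : polyfun 0 (fun z : 'rV[R]_m => a 0 b) by exact: polyfunC.
case: e => [[[i|[l j]]|l]|[a b]] /=.
- exact: polyfunB (polyfun_gram_tr _ pW)
    (polyfunB (polyfunC _ _ _) (@pdot _ _ 1 0 isT pY (pc (p i)))).
- exact: polyfunB (polyfun_gram_tr _ (pV l))
    (polyfunD (@pdot _ _ 0 1 isT (pc (h j).1) (pXr l)) (polyfunC _ _ _)).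
- exact: polyfunB (@pdot _ _ 1 1 isT pY (pXr l)) (polyfunC _ _ _).
- exact: polyfunB (@polyfun_mulmx _ _ 1 1 _ _ _ _ _ pX pT a b) (polyfunC _ _ _).
Qed.

Lemma equation_facet z : (0 < n)%N -> (forall e, equation e z = 0) ->
  exists j, vecY z = polar_point j.
Proof.
move=> n0 z0; have [Apsd Bpsd _] := factorS.
have XT : matX z *m matT z = 1%:M.
  apply/matrixP => a b; apply/eqP; rewrite -subr_eq0 [1%:M _ _]mxE.
  by have /= -> := z0 (inr (a, b)).
have [Xu _] := mulmx1_unit XT.
have Yp i : 0 <= 1 - dot (vecY z) (p i).
  have /= /eqP := z0 (inl (inl (inl i))); rewrite subr_eq0 => /eqP <-.
  exact: psdmx_gram_tr_ge0.
have YC : C `<=` [set x | dot (vecY z) x <= 1].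
  apply: (vertices_convex_ind irr.1 Cbd) => [y /vertexE[i ->]|x y t /andP[t0 t1]] /=.
    by rewrite -subr_ge0.
  by move=> x1 y1; rewrite dotDr !dotZr; nra.
have XC l : C (row l (matX z)).
  rewrite CE => j; have /= /eqP := z0 (inl (inl (inr (l, j)))).
  by rewrite subr_eq0 => /eqP <-; exact: psdmx_gram_tr_ge0.
have YX l : dot (vecY z) (row l (matX z)) = 1.
  by have /= /eqP := z0 (inl (inr l)); rewrite subr_eq0 => /eqP.
have [_ _ sur] := facetsC.
have [j _ jF] := sur _ (unitmx_facet n0 Xu YC XC YX).
(* Both [y] and the polar point solve the linear system with matrix [X] and all right-hand sides 1,
   whose solution is unique. *)
exists j; apply: trmx_inj; rewrite -[LHS](mulKmx Xu) -[RHS](mulKmx Xu).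
congr mulmx; apply/colP => l; rewrite -!dot_row YX.
have [_ /= /eqP] : (C `&` [set x | affine_eval (h j) x = 0]) (row l (matX z)).
  by rewrite jF; split; [exact: XC|exact: YX].
by rewrite polar_pointE mulf_eq0 gt_eqF ?h2_gt0 //= subr_eq0 => /eqP.
Qed.

(** The Gram factor [W] comes from [B j] divided by the offset of [h j], [X] from independent points
    of the facet, and each [V l] from the psd matrix of the [l]-th such point. *)
Lemma facet_equation j : exists z, vecY z = polar_point j /\ forall e, equation e z = 0.
Proof.
have [Apsd Bpsd AB] := factorS.
have /psdmx_gram[W WE] : psdmx ((h j).2^-1 *: B j).
  by apply: psdmxZ; [rewrite invr_ge0 ltW ?h2_gt0|exact: Bpsd].
have [X Xu XP] := facet_unitmx (lt0r_neq0 (h2_gt0 j)) (facet_hyperplane j).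
have /choice[V VP] : forall l, exists V : 'M[R]_k, forall j',
    \tr (B j' *m (V *m V^T)) = affine_eval (h j') (row l X).
  move=> l; have [D /psdmx_gram[V ->] DB] := slack_psd_point (XP l).1.
  by exists V => j'; rewrite mxtrace_mulC.
pose val (i : unknown) : R := match i with
  | inl (inl (inl (inl (a, b)))) => W a b
  | inl (inl (inl (inr (l, (a, b))))) => V l a b
  | inl (inl (inr a)) => polar_point j 0 a
  | inl (inr (a, b)) => X a b
  | inr (a, b) => invmx X a b
  end.
pose z : 'rV[R]_m := \row_i val (enum_val i).
have zE i : unknown_val z i = val i by rewrite /unknown_val mxE enum_rankK.
have WzE : matW z = W by apply/matrixP => a b; rewrite mxE zE.
have VzE l : matV l z = V l by apply/matrixP => a b; rewrite mxE zE.
have YzE : vecY z = polar_point j by apply/rowP => a; rewrite mxE zE.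
have XzE : matX z = X by apply/matrixP => a b; rewrite mxE zE.
have TzE : matT z = invmx X by apply/matrixP => a b; rewrite mxE zE.
exists z; split=> // -[[[i|[l j']]|l]|[a b]] /=.
- rewrite WzE YzE -WE -scalemxAr linearZ /= AB slackS polar_pointE.
  by rewrite mulKf ?gt_eqF ?h2_gt0 // subrr.
- by rewrite VzE XzE VP subrr.
- rewrite YzE XzE; have [_ /eqP] := XP l.
  by rewrite polar_pointE mulf_eq0 gt_eqF ?h2_gt0 //= subr_eq0 => /eqP <-; rewrite subrr.
- by rewrite XzE TzE mulmxV // mxE subrr.
Qed.

Lemma facets_le_psd :
  (0 < n)%N -> (f <= 5 ^ (k * k + n * (k * k) + n + n * n + n * n))%N.
Proof.
move=> n0; have /choice[z zP] := facet_equation.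
(* Cells are measured by the squared distance in the [y] coordinates only, since the other unknowns
   are not determined by the facet. *)
pose q j (x : 'rV[R]_m) := \sum_a (vecY x 0 a - polar_point j 0 a) ^+ 2.
have q0 j x : q j x = 0 <-> vecY x = polar_point j.
  split=> [/eqP|xj]; last by rewrite /q xj big1 // => a _; rewrite subrr expr0n.
  rewrite psumr_eq0 => [/allP xj|a _]; last exact: sqr_ge0.
  apply/rowP => a; apply/eqP; rewrite -subr_eq0 -sqrf_eq0.
  by have := xj a; rewrite mem_index_enum; apply.
have -> : (k * k + n * (k * k) + n + n * n + n * n)%N = m.
  by rewrite /m !card_sum !card_prod !card_ord.
apply: (@common_zeros_bound _ _ 2 f _ equation q z).
- exact: equation_polyfun.
- move=> j; apply: (@polyfun_continuous _ _ (1 + 1)); apply: polyfun_sum => a _.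
  apply: polyfun_sqr; apply: polyfunB; last exact: polyfunC.
  by apply: polyfun_ext (polyfun_coord _ (enum_rank (inl (inl (inr a)) : unknown))) _ => x; rewrite mxE.
- by move=> j x; apply: sumr_ge0 => a _; exact: sqr_ge0.
- by move=> j e; exact: (zP j).2.
- by move=> j; apply/q0; exact: (zP j).1.
- by move=> x /(equation_facet n0)[j xj]; exists j; apply/q0.
- by move=> j l x /q0 xj /q0 xl; apply: polar_point_inj; rewrite -xj -xl.
Qed.

Lemma psd_size_gt_dim : (0 < f)%N -> (n < k * k)%N.
Proof.
move=> f0; apply: (dim_le_psd C0 irr Cbd f0) => x /slack_psd_point[D _ DB].
by exists D.
Qed.

Lemma facets_dim_gt0 : (0 < f)%N -> (0 < n)%N.
Proof. by move=> f0; have [_ [d dn _]] := facet_hyperplane (Ordinal f0); rewrite -dn. Qed.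

End SlackMatrix.

(** * Numerical estimate and conclusion *)

Lemma facet_bound_arith n k : (0 < n)%N -> (n < k * k)%N ->
  (5 ^ (k * k + n * (k * k) + n + n * n + n * n) <= k ^ (15 * k ^ 2 * n))%N.
Proof.
move=> n0 nk; have k2 : (1 < k)%N by case: k nk => [|[|k]] //; lia.
have le5 : (5 <= k ^ 3)%N by apply: (@leq_trans (2 ^ 3)%N) => //; rewrite leq_exp2r.
(* Each of the five summands of the exponent is at most [k ^ 2 * n]; with [5 <= k ^ 3] this yields
   the constant [15 = 3 * 5]. *)
apply: (@leq_trans (5 ^ (5 * (k ^ 2 * n)))%N).
  by rewrite leq_exp2l // -mulnn; nia.
rewrite (_ : 15 * k ^ 2 * n = 3 * (5 * (k ^ 2 * n)))%N; last by ring.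
by rewrite (expnM k) leq_exp2r // !muln_gt0 n0 (ltnW k2).
Qed.

Theorem corollary4p18 (R : realType) :
  exists c : nat,
    forall (n : nat) (C : set 'rV[R]_n) (v f : nat) (S : 'M[R]_(v, f)) (k : nat),
      polytope C -> full_dimensional C -> interior C 0 ->
      slack_matrix S C -> psd_rank S k ->
      facets C #<= `I_(k ^ (c * k ^ 2 * n))%N.
Proof.
exists 15%N => n C v f S k Cpol _ C0 [h [p [irr facetsC verticesC slackS]]].
move=> [[A [B factorS]] _].
have Cbd := polytope_no_ray Cpol.
have fle : (f <= k ^ (15 * k ^ 2 * n))%N.
  (* Without facets the bound is trivial; one facet already gives [0 < n] and [n < k * k]. *)
  have [-> //|f0] := posnP f.
  have n0 := facets_dim_gt0 facetsC f0.
  have nk := psd_size_gt_dim C0 Cbd irr verticesC slackS factorS f0.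
  apply: leq_trans (facet_bound_arith n0 nk).
  exact: (facets_le_psd C0 Cbd irr facetsC verticesC slackS factorS n0).
have [_ _ sur] := facetsC.
apply: (card_le_trans (B := [set: 'I_f])).
  have <- : [set C `&` [set x | affine_eval (h j) x = 0] | j in [set: 'I_f]] = facets C.
    by apply/seteqP; split=> [F [j _ <-]|F /sur[j _ <-]];
      [have [sub _ _] := facetsC; apply: sub|exists j].
  exact: card_image_le.
apply: card_le_trans (_ : `I_f #<= _); last by rewrite card_le_II.
by have := @card_II f; rewrite card_eq_le => /andP[].
Qed.
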